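(* For every tempered distribution $f\in\mathcal{S}'(\mathbb{R})$, with second (distributional) derivative $f''$, the metamorphisms $\mathcal{M}f$ and $\mathcal{M}(f'')$ satisfy $$\mathcal{M}(f'') = \mathcal{D}_0\, \mathcal{M}f \quad\text{on } \mathbb{R}^3\times(0,\infty),$$ where $\mathcal{D}_0$ is the first-order differential operator $$\mathcal{D}_0 = 2\pi i\hbar\left( (b+ir^2)\,x\,\partial_x + x\,\partial_y + 2(b+ir^2)^2\,\partial_b + (b+ir^2) I\right).$$ That is, the metamorphism intertwines the second-order derivative with the first-order differential operator $\mathcal{D}_0$.
   Context: Fix a constant $\hbar>0$. The metamorphism of a function $f(u)$, $u\in\mathbb{R}$, is the function $\mathcal{M}f$ of $(x,y,b,r)\in\mathbb{R}\times\mathbb{R}\times\mathbb{R}\times(0,\infty)$ given by $$[\mathcal{M}f](x,y,b,r)=\sqrt{\hbar r}\int_{\mathbb{R}} f(u)\,\exp\left(-\pi\hbar\left((r^2-ib)(u-y)^2+2i(u-y)x\right)\right)\,du .$$ For each $(x,y,b,r)$ the integral kernel is a Schwartz function of $u$. For $f\in\mathcal{S}'(\mathbb{R})$ the integral is understood as the (bilinear) pairing of $f$ with this kernel; $\mathcal{M}f$ is then a smooth function of $(x,y,b,r)$. This covers in particular $f$ in the Schwartz space or in $L^p(\mathbb{R})$, $1\le p\le\infty$. $I$ denotes the identity operator. *)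

(* Defs.v *)
From Stdlib Require Import Reals Lra Lia FunctionalExtensionality ProofIrrelevance.
From Coquelicot Require Import Coquelicot.

Local Open Scope R_scope.

Definition Cexp (z : C) : C :=
  (exp (Re z) * cos (Im z), exp (Re z) * sin (Im z)).

(** Derivatives are taken componentwise, which is differentiation in the real
    normed space [C].  As [Derive] is total, [CDerive] and [CDerive_n] are
    meaningful only together with [ex_CDerive] and [ex_CDerive_n]. *)

Definition CDerive (phi : R -> C) (u : R) : C :=
  (Derive (fun t => Re (phi t)) u, Derive (fun t => Im (phi t)) u).

Definition ex_CDerive (phi : R -> C) (u : R) : Prop :=
  ex_derive (fun t => Re (phi t)) u /\ ex_derive (fun t => Im (phi t)) u.

Definition CDerive_n (phi : R -> C) (n : nat) (u : R) : C :=
  (Derive_n (fun t => Re (phi t)) n u, Derive_n (fun t => Im (phi t)) n u).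

Definition ex_CDerive_n (phi : R -> C) (n : nat) (u : R) : Prop :=
  ex_derive_n (fun t => Re (phi t)) n u /\
  ex_derive_n (fun t => Im (phi t)) n u.

(** That is, sup_u |u^m phi^(n)(u)| <= M. *)
Definition seminorm_le (m n : nat) (phi : R -> C) (M : R) : Prop :=
  forall u : R, Rabs (u ^ m) * Cmod (CDerive_n phi n u) <= M.

Definition is_schwartz (phi : R -> C) : Prop :=
  (forall (n : nat) (u : R), ex_CDerive_n phi n u) /\
  (forall m n : nat, exists M : R, seminorm_le m n phi M).

Record schwartz := Schwartz {
  schwartz_fun :> R -> C;
  schwartz_prop : is_schwartz schwartz_fun }.

(** Neighbourhoods for the locally convex topology generated by the seminorms
    sup_u |u^m phi^(n)(u)|. *)
Definition schwartz_nbhs (phi : schwartz) (P : schwartz -> Prop) : Prop :=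
  exists (N : nat) (delta : posreal), forall psi : schwartz,
    (forall m n : nat, (m <= N)%nat -> (n <= N)%nat ->
       seminorm_le m n (fun u => (psi u - phi u)%C) delta) ->
    P psi.

(** Real-valued analogue, used only to establish [is_schwartz] for the
    functions built below. *)
Definition rapid (g : R -> R) : Prop :=
  (forall n u, ex_derive_n g n u) /\
  (forall m n, exists M, forall u, Rabs (u ^ m) * Rabs (Derive_n g n u) <= M).

Lemma rapid_ext (g k : R -> R) :
  (forall u, g u = k u) -> rapid g -> rapid k.
Proof.
intros E [H1 H2]; split.
- intros n u; apply ex_derive_n_ext with g; auto.
- intros m n; destruct (H2 m n) as [M HM]; exists M; intros u.
  rewrite <- (Derive_n_ext g k n u E); apply HM.
Qed.

Lemma rapid_plus (g k : R -> R) :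
  rapid g -> rapid k -> rapid (fun u => g u + k u).
Proof.
intros [G1 G2] [K1 K2].
assert (LG : forall n x, locally x
  (fun y => forall j, (j <= n)%nat -> ex_derive_n g j y)).
{ intros n x; apply filter_forall; auto. }
assert (LK : forall n x, locally x
  (fun y => forall j, (j <= n)%nat -> ex_derive_n k j y)).
{ intros n x; apply filter_forall; auto. }
split.
- intros n u; apply ex_derive_n_plus; auto.
- intros m n; destruct (G2 m n) as [M HM]; destruct (K2 m n) as [L HL].
  exists (M + L); intros u.
  rewrite Derive_n_plus; auto.
  specialize (HM u); specialize (HL u).
  pose proof (Rabs_triang (Derive_n g n u) (Derive_n k n u)).
  pose proof (Rabs_pos (u ^ m)). nra.
Qed.

Lemma rapid_scal (a : R) (g : R -> R) : rapid g -> rapid (fun u => a * g u).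
Proof.
intros [G1 G2]; split.
- intros n u; apply ex_derive_n_scal_l; auto.
- intros m n; destruct (G2 m n) as [M HM]; exists (Rabs a * M); intros u.
  rewrite Derive_n_scal_l, Rabs_mult.
  specialize (HM u); pose proof (Rabs_pos a). nra.
Qed.

Lemma rapid_Derive (g : R -> R) : rapid g -> rapid (Derive g).
Proof.
intros [G1 G2].
assert (E : forall n u, Derive_n (Derive g) n u = Derive_n g (S n) u).
{ intros n u; rewrite <- (Nat.add_1_r n).
  exact (Derive_n_comp g n 1 u). }
split.
- intros [|n] u; [exact I|].
  apply ex_derive_ext with (Derive_n g (S n)); [auto|].
  exact (G1 (S (S n)) u).
- intros m n; destruct (G2 m (S n)) as [M HM]; exists M; intros u.
  rewrite E; apply HM.
Qed.

Lemma is_schwartz_rapid (phi : R -> C) :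
  is_schwartz phi <->
  rapid (fun u => Re (phi u)) /\ rapid (fun u => Im (phi u)).
Proof.
split.
- intros [H1 H2]; split; split; try (intros n u; apply H1);
  intros m n; destruct (H2 m n) as [M HM]; exists M; intros u;
  (eapply Rle_trans; [|apply (HM u)]);
  (apply Rmult_le_compat_l; [apply Rabs_pos|]);
  (eapply Rle_trans; [|apply Rmax_Cmod]); [apply Rmax_l | apply Rmax_r].
- intros [[G1 G2] [K1 K2]]; split.
  + intros n u; split; auto.
  + intros m n; destruct (G2 m n) as [M HM]; destruct (K2 m n) as [L HL].
    exists (M + L); intros u; specialize (HM u); specialize (HL u).
    assert (T : Cmod (CDerive_n phi n u) <=
      Rabs (Derive_n (fun t => Re (phi t)) n u) +
      Rabs (Derive_n (fun t => Im (phi t)) n u)).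
    { unfold CDerive_n, Cmod; simpl fst; simpl snd.
      set (p := Derive_n _ _ _); set (q := Derive_n _ _ _).
      pose proof (Rabs_pos p); pose proof (Rabs_pos q).
      rewrite <- (sqrt_Rsqr (Rabs p + Rabs q)) by lra.
      apply sqrt_le_1_alt; unfold Rsqr.
      pose proof (pow2_abs p); pose proof (pow2_abs q); nra. }
    pose proof (Rabs_pos (u ^ m)); nra.
Qed.

Lemma is_schwartz_plus (phi psi : schwartz) :
  is_schwartz (fun u => (phi u + psi u)%C).
Proof.
destruct phi as [phi Hp], psi as [psi Hq]; simpl.
apply is_schwartz_rapid in Hp; apply is_schwartz_rapid in Hq.
destruct Hp, Hq; apply is_schwartz_rapid; split; simpl;
now apply rapid_plus.
Qed.

Lemma is_schwartz_scal (a : C) (phi : schwartz) :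
  is_schwartz (fun u => (a * phi u)%C).
Proof.
destruct phi as [phi Hp]; simpl.
apply is_schwartz_rapid in Hp; destruct Hp as [H1 H2].
apply is_schwartz_rapid; split.
- apply (rapid_ext (fun u => Re a * Re (phi u) + - Im a * Im (phi u))).
  { intros u; unfold Re, Im, Cmult; simpl; ring. }
  apply rapid_plus; now apply rapid_scal.
- apply (rapid_ext (fun u => Re a * Im (phi u) + Im a * Re (phi u))).
  { intros u; unfold Re, Im, Cmult; simpl; ring. }
  apply rapid_plus; now apply rapid_scal.
Qed.

Lemma is_schwartz_deriv (phi : schwartz) : is_schwartz (CDerive phi).
Proof.
destruct phi as [phi Hp]; simpl.
apply is_schwartz_rapid in Hp; destruct Hp as [H1 H2].
apply is_schwartz_rapid; split; simpl; now apply rapid_Derive.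
Qed.

Definition schwartz_plus (phi psi : schwartz) : schwartz :=
  Schwartz _ (is_schwartz_plus phi psi).
Definition schwartz_scal (a : C) (phi : schwartz) : schwartz :=
  Schwartz _ (is_schwartz_scal a phi).
Definition schwartz_deriv (phi : schwartz) : schwartz :=
  Schwartz _ (is_schwartz_deriv phi).

Record is_tempered (f : schwartz -> C) : Prop := {
  tempered_plus : forall phi psi,
    f (schwartz_plus phi psi) = (f phi + f psi)%C;
  tempered_scal : forall (a : C) phi,
    f (schwartz_scal a phi) = (a * f phi)%C;
  tempered_cont : forall phi,
    filterlim f (schwartz_nbhs phi) (locally (f phi)) }.

Record tempered := Tempered {
  pairing :> schwartz -> C;
  tempered_prop : is_tempered pairing }.

Lemma schwartz_eq (phi psi : schwartz) :
  (forall u, phi u = psi u) -> phi = psi.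
Proof.
destruct phi as [phi Hp], psi as [psi Hq]; simpl; intros E.
apply functional_extensionality in E; subst psi.
f_equal; apply proof_irrelevance.
Qed.

Lemma schwartz_ex_derive (phi : schwartz) (u : R) : ex_CDerive phi u.
Proof. exact (proj1 (schwartz_prop phi) 1%nat u). Qed.

Lemma schwartz_deriv_plus (phi psi : schwartz) :
  schwartz_deriv (schwartz_plus phi psi) =
  schwartz_plus (schwartz_deriv phi) (schwartz_deriv psi).
Proof.
apply schwartz_eq; intros u; simpl.
destruct (schwartz_ex_derive phi u), (schwartz_ex_derive psi u).
unfold CDerive, Cplus, Re, Im in *; simpl; f_equal; now apply Derive_plus.
Qed.

Lemma schwartz_deriv_scal (a : C) (phi : schwartz) :
  schwartz_deriv (schwartz_scal a phi) = schwartz_scal a (schwartz_deriv phi).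
Proof.
apply schwartz_eq; intros u; simpl.
destruct (schwartz_ex_derive phi u).
unfold CDerive, Cmult, Re, Im in *; simpl; f_equal.
- rewrite Derive_minus by (apply ex_derive_scal; assumption).
  now rewrite !Derive_scal.
- rewrite Derive_plus by (apply ex_derive_scal; assumption).
  now rewrite !Derive_scal.
Qed.

Lemma schwartz_deriv_cont (phi : schwartz) :
  filterlim schwartz_deriv (schwartz_nbhs phi)
    (schwartz_nbhs (schwartz_deriv phi)).
Proof.
intros P (N & d & H); exists (S N), d; intros psi Hpsi.
apply H; intros m n Hm Hn u.
assert (E : CDerive_n (fun t => schwartz_deriv psi t - schwartz_deriv phi t)%C n u
          = CDerive_n (fun t => psi t - phi t)%C (S n) u).
{ unfold CDerive_n; rewrite <- (Nat.add_1_r n).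
  f_equal; rewrite <- Derive_n_comp; apply Derive_n_ext; intros t; simpl;
  destruct (schwartz_ex_derive phi t), (schwartz_ex_derive psi t);
  unfold Re, Im in *; simpl; symmetry; now apply Derive_minus. }
rewrite E; apply Hpsi; lia.
Qed.

Lemma is_tempered_deriv (f : tempered) :
  is_tempered (fun phi => (- f (schwartz_deriv phi))%C).
Proof.
destruct f as [f [Hp Hs Hc]]; simpl; split.
- intros phi psi; rewrite schwartz_deriv_plus, Hp; ring.
- intros a phi; rewrite schwartz_deriv_scal, Hs; ring.
- intros phi.
  apply (filterlim_comp _ _ _ (fun psi => f (schwartz_deriv psi)) Copp
           _ (locally (f (schwartz_deriv phi)))).
  + apply (filterlim_comp _ _ _ schwartz_deriv f _
             (schwartz_nbhs (schwartz_deriv phi))).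
    * apply schwartz_deriv_cont.
    * apply Hc.
  + exact (filterlim_opp (V := C_R_NormedModule) (f (schwartz_deriv phi))).
Qed.

Definition tempered_deriv (f : tempered) : tempered :=
  Tempered _ (is_tempered_deriv f).

Definition kernel (hbar : posreal) (x y b : R) (r : posreal) (u : R) : C :=
  Cexp (- (PI * hbar) *
        ((r ^ 2 - Ci * b) * (u - y) ^ 2 + 2 * Ci * (u - y) * x))%C.

Inductive polyn : (R -> R) -> Prop :=
| polyn_const c : polyn (fun _ => c)
| polyn_id : polyn (fun u => u)
| polyn_plus p q : polyn p -> polyn q -> polyn (fun u => p u + q u)
| polyn_mult p q : polyn p -> polyn q -> polyn (fun u => p u * q u).

Lemma polyn_derive (p : R -> R) :
  polyn p -> exists dp, polyn dp /\ forall u, is_derive p u (dp u).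
Proof.
induction 1 as [c| |p q Hp (dp & Pp & Dp) Hq (dq & Pq & Dq)
                   |p q Hp (dp & Pp & Dp) Hq (dq & Pq & Dq)].
- exists (fun _ => 0); split; [constructor|intros u; auto_derive; trivial].
- exists (fun _ => 1); split; [constructor|intros u; auto_derive; trivial].
- exists (fun u => dp u + dq u); split; [now constructor|].
  intros u; apply (is_derive_plus p q u (dp u) (dq u)); auto.
- exists (fun u => dp u * q u + p u * dq u); split.
  + repeat constructor; auto.
  + intros u; apply (is_derive_mult p q u (dp u) (dq u)); auto.
    intros; apply Rmult_comm.
Qed.

Lemma polyn_growth (y : R) (p : R -> R) : polyn p ->
  exists K k, 0 <= K /\ forall u, Rabs (p u) <= K * (1 + (u - y) ^ 2) ^ k.
Proof.
induction 1 as [c| |p q Hp (K & k & K0 & HK) Hq (L & l & L0 & HL)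
                   |p q Hp (K & k & K0 & HK) Hq (L & l & L0 & HL)].
- exists (Rabs c), 0%nat; split; [apply Rabs_pos|intros u; simpl; lra].
- exists (1 + Rabs y), 1%nat; pose proof (Rabs_pos y); split; [lra|intros u].
  rewrite pow_1; pose proof (Rabs_triang (u - y) y).
  replace (u - y + y) with u in * by ring.
  pose proof (pow2_abs (u - y)); pose proof (Rabs_pos (u - y)).
  assert (Rabs (u - y) <= 1 + (u - y) ^ 2) by nra.
  pose proof (pow2_ge_0 (u - y)).
  nra.
- exists (K + L), (k + l)%nat; split; [lra|intros u].
  specialize (HK u); specialize (HL u).
  assert (B : 1 <= 1 + (u - y) ^ 2) by (pose proof (pow2_ge_0 (u - y)); lra).
  pose proof (Rle_pow _ k (k + l) B ltac:(lia)).
  pose proof (Rle_pow _ l (k + l) B ltac:(lia)).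
  pose proof (Rabs_triang (p u) (q u)); nra.
- exists (K * L), (k + l)%nat; split; [now apply Rmult_le_pos|intros u].
  rewrite Rabs_mult, pow_add.
  replace (K * L * _) with
    ((K * (1 + (u - y) ^ 2) ^ k) * (L * (1 + (u - y) ^ 2) ^ l)) by ring.
  apply Rmult_le_compat; auto; apply Rabs_pos.
Qed.

Lemma gauss_bound (a : R) (k : nat) : 0 < a ->
  exists M, 0 <= M /\ forall v, (1 + v ^ 2) ^ k * exp (- a * v ^ 2) <= M.
Proof.
intros Ha.
assert (Hak : 0 < a ^ k) by now apply pow_lt.
pose proof (INR_fact_lt_0 k) as Hf.
exists (INR (Factorial.fact k) / a ^ k * exp a).
pose proof (exp_pos a); split.
{ apply Rmult_le_pos; [apply Rlt_le, Rdiv_lt_0_compat|]; lra. }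
intros v; set (t := a * (1 + v ^ 2)).
assert (Ht : 0 <= t) by (pose proof (pow2_ge_0 v); unfold t; nra).
assert (B : t ^ k / INR (Factorial.fact k) <= exp t).
{ eapply Rle_trans; [|apply (exp_ge_taylor t k Ht)].
  destruct k as [|k]; [simpl; lra|]; rewrite tech5.
  assert (0 <= sum_f_R0 (fun j => t ^ j / INR (Factorial.fact j)) k).
  { apply cond_pos_sum; intros j; apply Rmult_le_pos; [now apply pow_le|].
    apply Rlt_le, Rinv_0_lt_compat, INR_fact_lt_0. }
  lra. }
replace (exp a) with (exp t * exp (- a * v ^ 2))
  by (rewrite <- exp_plus; f_equal; unfold t; ring).
rewrite <- Rmult_assoc; apply Rmult_le_compat_r; [apply Rlt_le, exp_pos|].
replace ((1 + v ^ 2) ^ k)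
  with (INR (Factorial.fact k) / a ^ k * (t ^ k / INR (Factorial.fact k)))
  by (unfold t; rewrite Rpow_mult_distr; field; lra).
apply Rmult_le_compat_l; [|exact B].
apply Rlt_le, Rdiv_lt_0_compat; lra.
Qed.

(** The real and imaginary parts of [kernel] have this form with [p], [q]
    constant, and the form is stable under differentiation. *)
Definition osc (a y s x : R) (p q : R -> R) (u : R) : R :=
  (p u * cos (s * (u - y) ^ 2 - 2 * x * (u - y))
   + q u * sin (s * (u - y) ^ 2 - 2 * x * (u - y)))
  * exp (- a * (u - y) ^ 2).

Lemma osc_derive a y s x p q : polyn p -> polyn q ->
  exists dp dq, polyn dp /\ polyn dq /\
    forall u, is_derive (osc a y s x p q) u (osc a y s x dp dq u).
Proof.
intros Hp Hq.
destruct (polyn_derive p Hp) as (dp & Pp & Dp).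
destruct (polyn_derive q Hq) as (dq & Pq & Dq).
exists (fun u => (dp u + q u * (2 * s * (u + - y) + - 2 * x))
               + p u * (- 2 * a * (u + - y))),
       (fun u => (dq u + p u * (-2 * s * (u + - y) + 2 * x))
               + q u * (- 2 * a * (u + - y))).
split; [|split]; try (repeat constructor; assumption).
intros u; unfold osc.
assert (ex_derive p u) by (now exists (dp u)).
assert (ex_derive q u) by (now exists (dq u)).
auto_derive; [tauto|].
change (fun x0 : R => p x0) with p; change (fun x0 : R => q x0) with q.
rewrite (is_derive_unique _ _ _ (Dp u)), (is_derive_unique _ _ _ (Dq u)).
unfold Rminus; simpl; ring.
Qed.

Lemma osc_derive_n a y s x n p q : polyn p -> polyn q ->
  exists dp dq, polyn dp /\ polyn dq /\
    forall u, Derive_n (osc a y s x p q) n u = osc a y s x dp dq u.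
Proof.
intros Hp Hq; induction n as [|n (p' & q' & Pp & Pq & E)].
- now exists p, q.
- destruct (osc_derive a y s x p' q' Pp Pq) as (dp & dq & Dp & Dq & H).
  exists dp, dq; split; [|split]; try assumption.
  intros u; simpl; rewrite (Derive_ext _ _ u E).
  apply is_derive_unique, H.
Qed.

Lemma rapid_osc a y s x p q : 0 < a -> polyn p -> polyn q ->
  rapid (osc a y s x p q).
Proof.
intros Ha Hp Hq; split.
- intros [|n] u; [exact I|].
  destruct (osc_derive_n a y s x n p q Hp Hq) as (p' & q' & Pp & Pq & E).
  destruct (osc_derive a y s x p' q' Pp Pq) as (dp & dq & _ & _ & H).
  apply ex_derive_ext with (osc a y s x p' q'); [now intros|].
  now exists (osc a y s x dp dq u).
- intros m n.
  destruct (osc_derive_n a y s x n p q Hp Hq) as (p' & q' & Pp & Pq & E).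
  assert (Pm : polyn (fun u => u ^ m)).
  { induction m as [|m IH]; [exact (polyn_const 1)|].
    exact (polyn_mult _ _ polyn_id IH). }
  destruct (polyn_growth y _ (polyn_mult _ _ Pm Pp)) as (K & k & K0 & HK).
  destruct (polyn_growth y _ (polyn_mult _ _ Pm Pq)) as (L & l & L0 & HL).
  destruct (gauss_bound a k Ha) as (M & M0 & HM).
  destruct (gauss_bound a l Ha) as (M' & M0' & HM').
  exists (K * M + L * M'); intros u; rewrite E; unfold osc.
  set (th := s * (u - y) ^ 2 - 2 * x * (u - y)).
  specialize (HM (u - y)); specialize (HM' (u - y)).
  specialize (HK u); specialize (HL u); cbv beta in HK, HL.
  rewrite Rabs_mult in HK, HL.
  pose proof (exp_pos (- a * (u - y) ^ 2)) as He.
  set (e := exp _) in *.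
  rewrite Rabs_mult, (Rabs_pos_eq e) by lra.
  assert (Rabs (p' u * cos th + q' u * sin th) <= Rabs (p' u) + Rabs (q' u)).
  { eapply Rle_trans; [apply Rabs_triang|]; rewrite !Rabs_mult.
    assert (Rabs (cos th) <= 1) by (apply Rabs_le, COS_bound).
    assert (Rabs (sin th) <= 1) by (apply Rabs_le, SIN_bound).
    pose proof (Rabs_pos (p' u)); pose proof (Rabs_pos (q' u)); nra. }
  pose proof (Rabs_pos (u ^ m)).
  apply Rle_trans with
    ((Rabs (u ^ m) * Rabs (p' u) + Rabs (u ^ m) * Rabs (q' u)) * e).
  { rewrite <- Rmult_plus_distr_l, Rmult_assoc.
    apply Rmult_le_compat_l; [assumption|].
    apply Rmult_le_compat_r; lra. }
  apply Rle_trans with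
    (K * ((1 + (u - y) ^ 2) ^ k * e) + L * ((1 + (u - y) ^ 2) ^ l * e)).
  { rewrite <- !Rmult_assoc, <- Rmult_plus_distr_r.
    apply Rmult_le_compat_r; lra. }
  apply Rplus_le_compat; apply Rmult_le_compat_l; assumption.
Qed.

Lemma is_schwartz_kernel hbar x y b r : is_schwartz (kernel hbar x y b r).
Proof.
pose proof PI_RGT_0; pose proof (cond_pos hbar); pose proof (cond_pos r).
assert (Ha : 0 < PI * hbar * r ^ 2)
  by (apply Rmult_lt_0_compat; [nra|now apply pow_lt]).
apply is_schwartz_rapid; split;
[ apply (rapid_ext (osc (PI * hbar * r ^ 2) y (PI * hbar * b)
                        (PI * hbar * x) (fun _ => 1) (fun _ => 0)))
| apply (rapid_ext (osc (PI * hbar * r ^ 2) y (PI * hbar * b)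
                        (PI * hbar * x) (fun _ => 0) (fun _ => 1))) ];
try (apply rapid_osc; [exact Ha|apply polyn_const|apply polyn_const]);
intros u; unfold osc, kernel, Cexp.
all: set (z := Cmult _ _).
all: assert (Hre : Re z = - (PI * hbar * r ^ 2) * (u - y) ^ 2)
  by (unfold z, Re; simpl; ring).
all: assert (Him : Im z = PI * hbar * b * (u - y) ^ 2
                          - 2 * (PI * hbar * x) * (u - y))
  by (unfold z, Im; simpl; ring).
all: rewrite <- Hre, <- Him; unfold Re at 2 || unfold Im at 3; simpl; ring.
Qed.

Definition schwartz_kernel (hbar : posreal) (x y b : R) (r : posreal) :
  schwartz :=
  Schwartz _ (is_schwartz_kernel hbar x y b r).

Definition metamorphism (hbar : posreal) (f : tempered)
    (x y b : R) (r : posreal) : C :=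
  (sqrt (hbar * r) * f (schwartz_kernel hbar x y b r))%C.

Definition partial_x (F : R -> R -> R -> posreal -> C) x y b r : C :=
  CDerive (fun t => F t y b r) x.
Definition partial_y (F : R -> R -> R -> posreal -> C) x y b r : C :=
  CDerive (fun t => F x t b r) y.
Definition partial_b (F : R -> R -> R -> posreal -> C) x y b r : C :=
  CDerive (fun t => F x y t r) b.

(** [D0] uses the total [CDerive]; its value is meaningful under [ex_D0]. *)
Definition ex_D0 (F : R -> R -> R -> posreal -> C) x y b (r : posreal) : Prop :=
  ex_CDerive (fun t => F t y b r) x /\
  ex_CDerive (fun t => F x t b r) y /\
  ex_CDerive (fun t => F x y t r) b.

Definition D0 (hbar : posreal) (F : R -> R -> R -> posreal -> C)
    (x y b : R) (r : posreal) : C :=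
  let w := (b + Ci * r ^ 2)%C in
  (2 * PI * Ci * hbar *
    (w * x * partial_x F x y b r
     + x * partial_y F x y b r
     + 2 * w ^ 2 * partial_b F x y b r
     + w * F x y b r))%C.

(* Main.v *)
Require Import Defs.
From Stdlib Require Import Reals.
From Coquelicot Require Import Coquelicot.
From Stdlib Require Import Lra Lia FunctionalExtensionality.

(** The kernel [K] of the metamorphism is the exponential of a polynomial
    phase in the parameters [x], [y], [b] and the variable [u].  With
    [v = u - y], [c = r^2 - i b] and [w = b + i r^2 = i c], one computes
    [K_x = -2 pi hbar i v K], [K_y = pi hbar (2 c v + 2 i x) K],
    [K_b = pi hbar i v^2 K], and
    [K_uu = (pi^2 hbar^2 (2 c v + 2 i x)^2 - 2 pi hbar c) K].  The square
    expands into [c^2 v^2], [c v x] and [x^2], and these are exactly what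
    [w^2 K_b], [w x K_x] and [x K_y] produce, while [- 2 pi hbar c] equals
    [2 pi i hbar w], the term of order zero: the kernel itself satisfies
    [K_uu = D_0 K] ([gauss_intertwining]).  Since [r] only enters [D_0] as a
    coefficient, the factor [sqrt (hbar r)] is inert, and the two signs in the
    definition of the second distributional derivative cancel, so the claim
    follows by applying [f] to this identity, provided that [f] may be
    exchanged with the partial derivatives in [x], [y] and [b].

    That exchange is the analytic content.  As [f] is continuous and linear,
    it suffices that the difference quotients of the kernel in a parameter
    converge in the Schwartz topology ([tempered_is_derive],
    [gauss_schwartz_is_derive]).  All functions involved have the form [P K]
    with [P] a complex polynomial in [x, y, b, u]; a partial derivative
    replaces [P] by the twisted derivative [P_i + P phase_i] ([twist]), and
    twisted derivatives commute.  Hence the [n]-th [u]-derivative of the error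
    of a difference quotient is again such an error, now for another
    polynomial, and Taylor's formula of order two bounds it by [|h|] times the
    supremum of a function of the form [P K].  This supremum, even with a
    weight [u^m], is finite uniformly for bounded parameters, because the
    modulus of [K] is a Gaussian in [u] of fixed width ([gauss_decay]). *)

Local Open Scope R_scope.

(** * Derivatives of complex-valued functions of a real variable *)

Definition is_CDerive (phi : R -> C) (u : R) (l : C) : Prop :=
  is_derive (fun t => Re (phi t)) u (Re l) /\
  is_derive (fun t => Im (phi t)) u (Im l).

Lemma is_CDerive_unique phi u l : is_CDerive phi u l -> CDerive phi u = l.
Proof.
intros [H1 H2]; destruct l as [l1 l2]; unfold CDerive; f_equal;
now apply is_derive_unique.
Qed.

Lemma is_CDerive_ex phi u l : is_CDerive phi u l -> ex_CDerive phi u.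
Proof. intros [H1 H2]; split; eexists; eassumption. Qed.

Lemma is_CDerive_ext phi psi u l :
  (forall t, phi t = psi t) -> is_CDerive phi u l -> is_CDerive psi u l.
Proof.
intros E [H1 H2]; split; eapply is_derive_ext; try eassumption;
intros t; simpl; now rewrite E.
Qed.

Lemma is_CDerive_const c u : is_CDerive (fun _ => c) u 0.
Proof. split; apply (is_derive_const (V := R_NormedModule)). Qed.

Lemma is_CDerive_plus phi psi u k l :
  is_CDerive phi u k -> is_CDerive psi u l ->
  is_CDerive (fun t => (phi t + psi t)%C) u (k + l).
Proof.
intros [H1 H2] [H3 H4]; split.
- exact (is_derive_plus _ _ _ _ _ H1 H3).
- exact (is_derive_plus _ _ _ _ _ H2 H4).
Qed.

Lemma is_CDerive_mult phi psi u k l :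
  is_CDerive phi u k -> is_CDerive psi u l ->
  is_CDerive (fun t => (phi t * psi t)%C) u (k * psi u + phi u * l).
Proof.
intros [H1 H2] [H3 H4]; split.
- eapply is_derive_ext;
    [| evar_last;
       [ exact (is_derive_minus _ _ _ _ _
                 (is_derive_mult _ _ _ _ _ H1 H3 Rmult_comm)
                 (is_derive_mult _ _ _ _ _ H2 H4 Rmult_comm)) |] ].
  + reflexivity.
  + unfold minus, plus, opp, mult, Re, Im; simpl; ring.
- eapply is_derive_ext;
    [| evar_last;
       [ exact (is_derive_plus _ _ _ _ _
                 (is_derive_mult _ _ _ _ _ H1 H4 Rmult_comm)
                 (is_derive_mult _ _ _ _ _ H2 H3 Rmult_comm)) |] ].
  + reflexivity.
  + unfold minus, plus, opp, mult, Re, Im; simpl; ring.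
Qed.

Lemma is_CDerive_scal a phi u l :
  is_CDerive phi u l -> is_CDerive (fun t => (a * phi t)%C) u (a * l).
Proof.
intros H.
replace (a * l)%C with (0 * phi u + a * l)%C by ring.
apply (is_CDerive_mult (fun _ => a)); [apply is_CDerive_const|exact H].
Qed.

Lemma is_CDerive_exp phi u l :
  is_CDerive phi u l ->
  is_CDerive (fun t => Cexp (phi t)) u (l * Cexp (phi u)).
Proof.
unfold Cexp, Re, Im; intros [H1 H2]; split; simpl.
- pose proof (is_derive_comp exp _ u _ _ (is_derive_exp _) H1) as E.
  pose proof (is_derive_comp cos _ u _ _ (is_derive_cos _) H2) as T.
  evar_last; [exact (is_derive_mult _ _ _ _ _ E T Rmult_comm)|].
  unfold plus, mult, scal, Re, Im; simpl; unfold mult; simpl; ring.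
- pose proof (is_derive_comp exp _ u _ _ (is_derive_exp _) H1) as E.
  pose proof (is_derive_comp sin _ u _ _ (is_derive_sin _) H2) as T.
  evar_last; [exact (is_derive_mult _ _ _ _ _ E T Rmult_comm)|].
  unfold plus, mult, scal, Re, Im; simpl; unfold mult; simpl; ring.
Qed.

(** Iterated derivatives are found by guessing all of them at once: a sequence
    in which each term differentiates the previous one. *)
Lemma CDerive_n_chain (F : nat -> R -> C) :
  (forall n u, is_CDerive (F n) u (F (S n) u)) ->
  forall n u, ex_CDerive_n (F 0%nat) n u /\ CDerive_n (F 0%nat) n u = F n u.
Proof.
intros H.
assert (E : forall n u,
  Derive_n (fun t => Re (F 0%nat t)) n u = Re (F n u) /\
  Derive_n (fun t => Im (F 0%nat t)) n u = Im (F n u)).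
{ induction n as [|n IH]; intros u; [now split|]; simpl; split.
  - rewrite (Derive_ext _ _ u (fun t => proj1 (IH t))).
    apply is_derive_unique, H.
  - rewrite (Derive_ext _ _ u (fun t => proj2 (IH t))).
    apply is_derive_unique, H. }
intros n u; split.
- destruct n as [|n]; [now split|]; split.
  + apply ex_derive_ext with (fun t => Re (F n t)).
    * intros t; symmetry; apply E.
    * exists (Re (F (S n) u)); exact (proj1 (H n u)).
  + apply ex_derive_ext with (fun t => Im (F n t)).
    * intros t; symmetry; apply E.
    * exists (Im (F (S n) u)); exact (proj2 (H n u)).
- unfold CDerive_n; rewrite (proj1 (E n u)), (proj2 (E n u)).
  now destruct (F n u).
Qed.

(** Two applications of the mean value theorem; the quotient equals [g' c] with
    [c] between [t] and [t + h], whence the factor [|h|] and no constant. *)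
Lemma taylor_quotient (g g' g'' : R -> R) (t h M : R) :
  (forall s, is_derive g s (g' s)) -> (forall s, is_derive g' s (g'' s)) ->
  h <> 0 -> (forall s, Rabs (s - t) <= Rabs h -> Rabs (g'' s) <= M) ->
  Rabs (/ h * (g (t + h) - g t) - g' t) <= M * Rabs h.
Proof.
intros H1 H2 Hh HM.
assert (C1 : forall s, continuity_pt g s).
{ intros s; apply derivable_continuous_pt; exists (g' s).
  apply is_derive_Reals, H1. }
assert (C2 : forall s, continuity_pt g' s).
{ intros s; apply derivable_continuous_pt; exists (g'' s).
  apply is_derive_Reals, H2. }
destruct (MVT_gen g t (t + h) g') as (c & Hc & Ec); auto.
destruct (MVT_gen g' t c g'') as (d & Hd & Ed); auto.
assert (Bc : Rabs (c - t) <= Rabs h).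
{ revert Hc; unfold Rmin, Rmax, Rabs.
  destruct (Rle_dec t (t + h)), (Rcase_abs (c - t)), (Rcase_abs h); lra. }
assert (Bd : Rabs (d - t) <= Rabs h).
{ eapply Rle_trans; [|exact Bc].
  revert Hd; unfold Rmin, Rmax, Rabs.
  destruct (Rle_dec t c), (Rcase_abs (d - t)), (Rcase_abs (c - t)); lra. }
rewrite Ec; replace (/ h * _ - g' t) with (g' c - g' t) by (field; exact Hh).
rewrite Ed, Rabs_mult; apply Rmult_le_compat; auto using Rabs_pos.
Qed.

Lemma Cmod_le_sum (z : C) : Cmod z <= Rabs (Re z) + Rabs (Im z).
Proof.
unfold Cmod, Re, Im; set (p := fst z); set (q := snd z).
pose proof (Rabs_pos p); pose proof (Rabs_pos q).
rewrite <- (sqrt_Rsqr (Rabs p + Rabs q)) by lra.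
apply sqrt_le_1_alt; unfold Rsqr.
pose proof (pow2_abs p); pose proof (pow2_abs q); nra.
Qed.

(** The mean value theorem fails for complex values, so the real and imaginary
    parts are estimated separately, at the cost of the factor [2]. *)
Lemma taylor_quotient_C (g g' g'' : R -> C) (t h M : R) :
  (forall s, is_CDerive g s (g' s)) -> (forall s, is_CDerive g' s (g'' s)) ->
  h <> 0 -> (forall s, Rabs (s - t) <= Rabs h -> Cmod (g'' s) <= M) ->
  Cmod (RtoC (/ h) * (g (t + h)%R - g t) - g' t) <= 2 * M * Rabs h.
Proof.
intros H1 H2 Hh HM.
assert (T1 : Rabs (/ h * (Re (g (t + h)) - Re (g t)) - Re (g' t)) <= M * Rabs h).
{ apply (taylor_quotient (fun s => Re (g s)) (fun s => Re (g' s))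
           (fun s => Re (g'' s))); try (intros; apply H1 || apply H2); auto.
  intros s Hs; eapply Rle_trans; [|apply (HM s Hs)].
  eapply Rle_trans; [apply Rmax_l|apply Rmax_Cmod]. }
assert (T2 : Rabs (/ h * (Im (g (t + h)) - Im (g t)) - Im (g' t)) <= M * Rabs h).
{ apply (taylor_quotient (fun s => Im (g s)) (fun s => Im (g' s))
           (fun s => Im (g'' s))); try (intros; apply H1 || apply H2); auto.
  intros s Hs; eapply Rle_trans; [|apply (HM s Hs)].
  eapply Rle_trans; [apply Rmax_r|apply Rmax_Cmod]. }
eapply Rle_trans; [apply Cmod_le_sum|].
replace (2 * M * Rabs h) with (M * Rabs h + M * Rabs h) by ring.
apply Rplus_le_compat.
- eapply Rle_trans; [|exact T1]; right; f_equal; unfold Re, Im; simpl; ring.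
- eapply Rle_trans; [|exact T2]; right; f_equal; unfold Re, Im; simpl; ring.
Qed.

(** * Differentiating a family of Schwartz functions under a distribution *)

(** A neighbourhood in the Schwartz space constrains the seminorms with both
    indices at most [N]; this turns a bound for each of them into a common
    one. *)
Lemma finite_grid_bound (P : nat -> nat -> R -> Prop) (N : nat) :
  (forall m n M M', M <= M' -> P m n M -> P m n M') ->
  (forall m n, exists M, P m n M) ->
  exists M, 0 <= M /\
    forall m n, (m <= N)%nat -> (n <= N)%nat -> P m n M.
Proof.
intros Hmono Hex.
assert (Row : forall m k, exists M, 0 <= M /\
  forall n, (n <= k)%nat -> P m n M).
{ intros m; induction k as [|k (M & M0 & HM)].
  - destruct (Hex m 0%nat) as [M HM]; exists (Rmax 0 M).
    split; [apply Rmax_l|intros n Hn].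
    replace n with 0%nat by lia; eapply Hmono; [apply Rmax_r|exact HM].
  - destruct (Hex m (S k)) as [L HL]; exists (Rmax M L).
    pose proof (Rmax_l M L); split; [lra|intros n Hn].
    destruct (Nat.eq_dec n (S k)) as [->|].
    + eapply Hmono; [apply Rmax_r|exact HL].
    + eapply Hmono; [apply Rmax_l|apply HM; lia]. }
assert (All : forall k, exists M, 0 <= M /\
  forall m n, (m <= k)%nat -> (n <= N)%nat -> P m n M).
{ induction k as [|k (M & M0 & HM)].
  - destruct (Row 0%nat N) as (M & M0 & HM); exists M; split; [exact M0|].
    intros m n Hm; replace m with 0%nat by lia; apply HM.
  - destruct (Row (S k) N) as (L & L0 & HL); exists (Rmax M L).
    pose proof (Rmax_l M L); split; [lra|intros m n Hm Hn].
    destruct (Nat.eq_dec m (S k)) as [->|].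
    + eapply Hmono; [apply Rmax_r|apply HL, Hn].
    + eapply Hmono; [apply Rmax_l|apply HM; lia]. }
exact (All N).
Qed.

Definition schwartz_quotient (Phi : R -> schwartz) (t h : R) : schwartz :=
  schwartz_scal (RtoC (/ h))
    (schwartz_plus (Phi (t + h)) (schwartz_scal (RtoC (-1)) (Phi t))).

Definition schwartz_is_derive (Phi : R -> schwartz) (t : R) (psi : schwartz) :=
  filterlim (schwartz_quotient Phi t) (locally' 0) (schwartz_nbhs psi).

(** By linearity [f] maps difference quotients to difference quotients, and by
    continuity it preserves their limit. *)
Lemma tempered_is_derive (f : tempered) Phi t psi :
  schwartz_is_derive Phi t psi ->
  is_CDerive (fun s => f (Phi s)) t (f psi).
Proof.
intros H; destruct (tempered_prop f) as [Hp Hs Hc].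
pose proof (filterlim_comp _ _ _ _ _ _ _ _ H (Hc psi)) as L.
assert (Q : forall eps : posreal, exists d : posreal, forall h, h <> 0 ->
  Rabs h < d ->
  Rabs (/ h * (Re (f (Phi (t + h))) - Re (f (Phi t))) - Re (f psi)) < eps /\
  Rabs (/ h * (Im (f (Phi (t + h))) - Im (f (Phi t))) - Im (f psi)) < eps).
{ intros eps.
  destruct (L _ (locally_ball (f psi) eps)) as [d Hd].
  exists d; intros h Hh Bh.
  assert (B0 : ball 0 d h).
  { unfold ball; simpl; unfold AbsRing_ball, abs, minus, plus, opp; simpl.
    now replace (h + - 0) with h by lra. }
  destruct (Hd h B0 Hh) as [B1 B2]; revert B1 B2.
  unfold schwartz_quotient; rewrite Hs, Hp, Hs.
  unfold ball; simpl; unfold AbsRing_ball, abs, minus, plus, opp, Re, Im; simpl.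
  intros B1 B2; split.
  - eapply Rle_lt_trans; [|exact B1]; right; f_equal; ring.
  - eapply Rle_lt_trans; [|exact B2]; right; f_equal; ring. }
split; apply is_derive_Reals; intros eps He;
  destruct (Q (mkposreal eps He)) as [d Hd]; exists d; intros h Hh Bh;
  destruct (Hd h Hh Bh) as [B1 B2]; unfold Rdiv; rewrite Rmult_comm; assumption.
Qed.

(** * Polynomials in the parameters and the variable *)

Inductive var := vx | vy | vb | vu.

Definition var_eqb (i j : var) : bool :=
  match i, j with
  | vx, vx | vy, vy | vb, vb | vu, vu => true
  | _, _ => false
  end.

Definition upd (e : var -> R) (i : var) (t : R) : var -> R :=
  fun j => if var_eqb i j then t else e j.

Lemma upd_upd_comm e i j s t :
  i <> j -> upd (upd e i s) j t = upd (upd e j t) i s.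
Proof.
intros H; apply functional_extensionality; intros k; unfold upd.
destruct i, j, k; simpl; congruence.
Qed.

Lemma upd_id e i : upd e i (e i) = e.
Proof.
apply functional_extensionality; intros k; unfold upd.
now destruct i, k.
Qed.

(** Syntactic polynomials: partial derivatives are then computed formally, and
    their commutation is an induction instead of an appeal to Schwarz's
    theorem on mixed partial derivatives. *)
Inductive cpoly :=
| Cst (c : C)
| Var (i : var)
| Add (p q : cpoly)
| Mul (p q : cpoly).

Fixpoint eval (p : cpoly) (e : var -> R) : C :=
  match p with
  | Cst c => c
  | Var i => RtoC (e i)
  | Add p q => (eval p e + eval q e)%C
  | Mul p q => (eval p e * eval q e)%C
  end.

Fixpoint pd (i : var) (p : cpoly) : cpoly :=
  match p with
  | Cst _ => Cst 0
  | Var j => Cst (if var_eqb i j then 1 else 0)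
  | Add p q => Add (pd i p) (pd i q)
  | Mul p q => Add (Mul (pd i p) q) (Mul p (pd i q))
  end.

(** Only the values agree: the two derivatives of a product list the same terms
    in a different order. *)
Lemma pd_comm i j p e : eval (pd i (pd j p)) e = eval (pd j (pd i p)) e.
Proof.
induction p as [c|k|p IHp q IHq|p IHp q IHq]; simpl; try reflexivity.
- now rewrite IHp, IHq.
- rewrite IHp, IHq; ring.
Qed.

Lemma eval_is_CDerive p e i t :
  is_CDerive (fun s => eval p (upd e i s)) t (eval (pd i p) (upd e i t)).
Proof.
induction p as [c|k|p IHp q IHq|p IHp q IHq]; simpl.
- apply is_CDerive_const.
- unfold upd; destruct (var_eqb i k); [|apply is_CDerive_const].
  split; simpl.
  + apply (is_derive_id (K := R_AbsRing)).
  + apply (is_derive_const (V := R_NormedModule)).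
- now apply is_CDerive_plus.
- now apply (is_CDerive_mult (fun s => eval p (upd e i s))).
Qed.

(** The variable [u] stays free: estimates are uniform in the parameters on
    bounded sets, with control of the growth in [u]. *)
Definition params_le (B : R) (e : var -> R) : Prop :=
  Rabs (e vx) <= B /\ Rabs (e vy) <= B /\ Rabs (e vb) <= B.

Lemma params_le_ex e : exists B, params_le B e.
Proof.
exists (Rabs (e vx) + Rabs (e vy) + Rabs (e vb)).
pose proof (Rabs_pos (e vx)); pose proof (Rabs_pos (e vy)).
pose proof (Rabs_pos (e vb)); unfold params_le; lra.
Qed.

Lemma eval_growth (B : R) (p : cpoly) :
  exists K k, 0 <= K /\ forall e, params_le B e ->
    Cmod (eval p e) <= K * (1 + e vu ^ 2) ^ k.
Proof.
induction p as [c|i|p (K & k & K0 & HK) q (L & l & L0 & HL)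
                   |p (K & k & K0 & HK) q (L & l & L0 & HL)]; simpl.
- exists (Cmod c), 0%nat; split; [apply Cmod_ge_0|intros e _; simpl; lra].
- exists (Rmax B 1), 1%nat.
  pose proof (Rmax_l B 1); pose proof (Rmax_r B 1).
  split; [lra|intros e (H1 & H2 & H3)].
  rewrite Cmod_R, pow_1.
  pose proof (pow2_ge_0 (e vu)); pose proof (pow2_abs (e vu)).
  assert (T : Rmax B 1 * 1 <= Rmax B 1 * (1 + e vu ^ 2))
    by (apply Rmult_le_compat_l; lra).
  destruct i; try lra.
  apply Rle_trans with (1 * (1 + e vu ^ 2)); [nra|].
  apply Rmult_le_compat_r; lra.
- exists (K + L), (k + l)%nat; split; [lra|intros e He].
  specialize (HK e He); specialize (HL e He).
  assert (O : 1 <= 1 + e vu ^ 2) by (pose proof (pow2_ge_0 (e vu)); lra).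
  pose proof (Rle_pow _ k (k + l) O ltac:(lia)).
  pose proof (Rle_pow _ l (k + l) O ltac:(lia)).
  pose proof (Cmod_triangle (eval p e) (eval q e)); simpl in *; nra.
- exists (K * L), (k + l)%nat; split; [now apply Rmult_le_pos|intros e He].
  rewrite Cmod_mult, pow_add.
  replace (K * L * _) with
    ((K * (1 + e vu ^ 2) ^ k) * (L * (1 + e vu ^ 2) ^ l)) by (simpl; ring).
  apply Rmult_le_compat; auto using Cmod_ge_0.
Qed.

Lemma Cmod_Cexp z : Cmod (Cexp z) = exp (Re z).
Proof.
unfold Cmod, Cexp; cbn [fst snd].
replace (_ + _) with (Rsqr (exp (Re z))).
- apply sqrt_Rsqr, Rlt_le, exp_pos.
- pose proof (sin2_cos2 (Im z)) as E; unfold Rsqr in *; simpl.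
  set (s := sin _) in *; set (c := cos _) in *; set (m := exp _).
  transitivity (m * m * (s * s + c * c)); [rewrite E|]; ring.
Qed.

(** * Polynomial multiples of the Gaussian kernel *)

Section Gauss.

Variables (hbar r : posreal).

Definition phase : cpoly :=
  let v := Add (Var vu) (Mul (Cst (- (1))%C) (Var vy)) in
  Mul (Cst (- (PI * hbar))%C)
    (Add (Mul (Add (Cst (r ^ 2)%C) (Mul (Cst (- Ci)%C) (Var vb))) (Mul v v))
         (Mul (Cst (2 * Ci)%C) (Mul v (Var vx)))).

Definition gauss (p : cpoly) (e : var -> R) : C :=
  (eval p e * Cexp (eval phase e))%C.

(** The logarithmic derivative of the exponential factor is the derivative of
    the phase, so that differentiating [P exp(phase)] amounts to applying
    [P |-> P_i + P phase_i] to the polynomial factor. *)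
Definition twist (i : var) (p : cpoly) : cpoly :=
  Add (pd i p) (Mul p (pd i phase)).

Lemma gauss_is_CDerive p e i t :
  is_CDerive (fun s => gauss p (upd e i s)) t (gauss (twist i p) (upd e i t)).
Proof.
unfold gauss.
replace (eval (twist i p) (upd e i t) * _)%C with
  (eval (pd i p) (upd e i t) * Cexp (eval phase (upd e i t))
   + eval p (upd e i t) *
     (eval (pd i phase) (upd e i t) * Cexp (eval phase (upd e i t))))%C
  by (cbn [twist eval]; ring).
apply (is_CDerive_mult (fun s => eval p (upd e i s))
         (fun s => Cexp (eval phase (upd e i s)))).
- apply eval_is_CDerive.
- apply (is_CDerive_exp (fun s => eval phase (upd e i s))), eval_is_CDerive.
Qed.

Lemma twist_comm i j p e :
  gauss (twist i (twist j p)) e = gauss (twist j (twist i p)) e.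
Proof.
unfold gauss, twist; cbn [eval pd].
rewrite (pd_comm i j p), (pd_comm i j phase); ring.
Qed.

Lemma gauss_modulus e :
  Cmod (Cexp (eval phase e)) = exp (- (PI * hbar * r ^ 2) * (e vu - e vy) ^ 2).
Proof. rewrite Cmod_Cexp; f_equal; unfold Re; simpl; ring. Qed.

(** For [|y| <= B] completing the square gives
    [(u - y)^2 >= u^2 / 2 - B^2]; half of the Gaussian rate, centred at the
    origin whatever the parameters are, is left to absorb the polynomial
    growth. *)
Lemma gauss_decay (B : R) (m : nat) (p : cpoly) :
  exists M, 0 <= M /\ forall e, params_le B e ->
    Rabs (e vu ^ m) * Cmod (gauss p e) <= M.
Proof.
set (a := PI * hbar * r ^ 2).
assert (Ha : 0 < a).
{ pose proof PI_RGT_0; pose proof (cond_pos hbar); pose proof (cond_pos r).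
  apply Rmult_lt_0_compat; [nra|now apply pow_lt]. }
destruct (eval_growth B p) as (K & k & K0 & HK).
destruct (gauss_bound (a / 2) (m + k)) as (M & M0 & HM); [lra|].
exists (K * exp (a * B ^ 2) * M).
pose proof (exp_pos (a * B ^ 2)) as Ep.
split; [repeat apply Rmult_le_pos; lra|intros e He].
specialize (HK e He); specialize (HM (e vu)).
destruct He as (_ & Hy & _).
unfold gauss; rewrite Cmod_mult, gauss_modulus; fold a.
set (u := e vu) in *; set (y := e vy) in *.
assert (O : 1 <= 1 + u ^ 2) by (pose proof (pow2_ge_0 u); lra).
assert (Um : Rabs (u ^ m) <= (1 + u ^ 2) ^ m).
{ rewrite <- RPow_abs; apply pow_incr; split; [apply Rabs_pos|].
  pose proof (pow2_abs u); pose proof (Rabs_pos u); nra. }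
assert (Ee : exp (- a * (u - y) ^ 2) <= exp (a * B ^ 2) * exp (- (a / 2) * u ^ 2)).
{ rewrite <- exp_plus; apply Rnot_lt_le; intros L; apply exp_lt_inv in L.
  assert (Y : y ^ 2 <= B ^ 2)
    by (rewrite <- (pow2_abs y); apply pow_incr; split;
        [apply Rabs_pos|exact Hy]).
  pose proof (pow2_ge_0 (u - 2 * y)).
  assert (0 <= a * (B ^ 2 - y ^ 2)) by (apply Rmult_le_pos; lra).
  assert (0 <= a * (u - 2 * y) ^ 2) by (apply Rmult_le_pos; lra).
  nra. }
apply Rle_trans with
  ((1 + u ^ 2) ^ m * ((K * (1 + u ^ 2) ^ k) *
    (exp (a * B ^ 2) * exp (- (a / 2) * u ^ 2)))).
{ apply Rmult_le_compat; [apply Rabs_pos| |exact Um|].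
  - apply Rmult_le_pos; [apply Cmod_ge_0|apply Rlt_le, exp_pos].
  - apply Rmult_le_compat; auto; [apply Cmod_ge_0|apply Rlt_le, exp_pos]. }
rewrite pow_add in HM.
replace (_ * _) with
  (K * exp (a * B ^ 2) *
   ((1 + u ^ 2) ^ m * (1 + u ^ 2) ^ k * exp (- (a / 2) * u ^ 2))) by ring.
apply Rmult_le_compat_l; [apply Rmult_le_pos; lra|exact HM].
Qed.

Fixpoint twist_u_n (n : nat) (p : cpoly) : cpoly :=
  match n with
  | O => p
  | S n => twist vu (twist_u_n n p)
  end.

Lemma gauss_derive_n p e n u :
  ex_CDerive_n (fun s => gauss p (upd e vu s)) n u /\
  CDerive_n (fun s => gauss p (upd e vu s)) n u
  = gauss (twist_u_n n p) (upd e vu u).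
Proof.
apply (CDerive_n_chain (fun n s => gauss (twist_u_n n p) (upd e vu s))).
intros; apply gauss_is_CDerive.
Qed.

Lemma is_schwartz_gauss p e : is_schwartz (fun u => gauss p (upd e vu u)).
Proof.
split.
- intros n u; apply gauss_derive_n.
- intros m n; destruct (params_le_ex e) as [B HB].
  destruct (gauss_decay B m (twist_u_n n p)) as (M & _ & HM).
  exists M; intros u; rewrite (proj2 (gauss_derive_n p e n u)).
  exact (HM (upd e vu u) HB).
Qed.

Definition schwartz_gauss (p : cpoly) (e : var -> R) : schwartz :=
  Schwartz _ (is_schwartz_gauss p e).

Lemma schwartz_deriv_gauss p e :
  schwartz_deriv (schwartz_gauss p e) = schwartz_gauss (twist vu p) e.
Proof.
apply schwartz_eq; intros u; simpl.
apply is_CDerive_unique, gauss_is_CDerive.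
Qed.

(** The error of the difference quotient in the parameter [i] commutes with
    differentiation in [u] because twists commute, so each of its
    [u]-derivatives is controlled by the order-two Taylor bound. *)
Lemma gauss_quotient_bound p e i t m n : i <> vu ->
  exists M, 0 <= M /\ forall h, h <> 0 -> Rabs h <= 1 ->
    seminorm_le m n
      (fun u => (schwartz_quotient (fun s => schwartz_gauss p (upd e i s)) t h u
                 - schwartz_gauss (twist i p) (upd e i t) u)%C)
      (M * Rabs h).
Proof.
intros Hi.
assert (HB : exists B, forall s u, Rabs (s - t) <= 1 ->
  params_le B (upd (upd e i s) vu u)).
{ destruct (params_le_ex e) as [B (H1 & H2 & H3)].
  exists (B + (1 + Rabs t)); intros s u Hs.
  pose proof (Rabs_pos t); pose proof (Rabs_pos (e vx)).
  assert (Rabs s <= 1 + Rabs t)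
    by (replace s with ((s - t) + t) by ring;
        eapply Rle_trans; [apply Rabs_triang|lra]).
  unfold params_le, upd; destruct i; simpl; lra. }
destruct HB as [B HB].
destruct (gauss_decay B m (twist i (twist i (twist_u_n n p)))) as (M & M0 & HM).
exists (2 * M); split; [lra|intros h Hh Bh u].
(* The candidate for the successive [u]-derivatives of the error; the minus
   signs are written as in [schwartz_quotient]. *)
set (F := fun n u =>
  (RtoC (/ h) * (gauss (twist_u_n n p) (upd (upd e i (t + h)%R) vu u)
                 + RtoC (-1) * gauss (twist_u_n n p) (upd (upd e i t) vu u))
   + RtoC (-1) * gauss (twist i (twist_u_n n p)) (upd (upd e i t) vu u))%C).
assert (HF : forall k v, is_CDerive (F k) v (F (S k) v)).
{ intros k v; unfold F; cbn [twist_u_n]; rewrite (twist_comm i vu).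
  apply is_CDerive_plus; [apply is_CDerive_scal, is_CDerive_plus|];
    [|apply is_CDerive_scal|apply is_CDerive_scal]; apply gauss_is_CDerive. }
replace (CDerive_n _ n u) with (F n u).
2:{ rewrite <- (proj2 (CDerive_n_chain F HF n u)); f_equal.
    apply functional_extensionality; intros v; unfold F; simpl; ring. }
unfold F; rewrite !(upd_upd_comm e i vu) by exact Hi.
set (e' := upd e vu u); set (q := twist_u_n n p) in *.
replace (Rabs (u ^ m)) with (Cmod (RtoC (u ^ m))) by apply Cmod_R.
rewrite <- Cmod_mult.
(* The weight [u^m] does not depend on the parameter and is moved inside the
   function to which Taylor's formula is applied. *)
replace (_ * _)%C with
  (RtoC (/ h) * (RtoC (u ^ m) * gauss q (upd e' i (t + h)%R)
                 - RtoC (u ^ m) * gauss q (upd e' i t))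
   - RtoC (u ^ m) * gauss (twist i q) (upd e' i t))%C by ring.
apply (taylor_quotient_C (fun s => (RtoC (u ^ m) * gauss q (upd e' i s))%C)
         (fun s => (RtoC (u ^ m) * gauss (twist i q) (upd e' i s))%C)
         (fun s => (RtoC (u ^ m) * gauss (twist i (twist i q)) (upd e' i s))%C));
  try (intros s; apply is_CDerive_scal, gauss_is_CDerive); [exact Hh|].
intros s Hs; rewrite Cmod_mult, Cmod_R; unfold e'.
rewrite <- (upd_upd_comm e i vu) by exact Hi.
apply (HM (upd (upd e i s) vu u)), HB; lra.
Qed.

Lemma gauss_schwartz_is_derive p e i t : i <> vu ->
  schwartz_is_derive (fun s => schwartz_gauss p (upd e i s)) t
    (schwartz_gauss (twist i p) (upd e i t)).
Proof.
intros Hi P (N & d & H).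
destruct (finite_grid_bound
  (fun m n M => 0 <= M /\ forall h, h <> 0 -> Rabs h <= 1 ->
    seminorm_le m n
      (fun u => (schwartz_quotient (fun s => schwartz_gauss p (upd e i s)) t h u
                 - schwartz_gauss (twist i p) (upd e i t) u)%C)
      (M * Rabs h)) N) as (M & M0 & HM).
{ intros m n M M' HM [H0 HS]; split; [lra|intros h Hh Bh u].
  eapply Rle_trans; [apply (HS h Hh Bh u)|].
  apply Rmult_le_compat_r; [apply Rabs_pos|exact HM]. }
{ intros m n; now apply gauss_quotient_bound. }
assert (Hd : 0 < Rmin 1 (d / (M + 1))).
{ apply Rmin_glb_lt; [lra|apply Rdiv_lt_0_compat; [apply cond_pos|lra]]. }
exists (mkposreal _ Hd); intros h Bh Hh.
assert (B : Rabs h < Rmin 1 (d / (M + 1))).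
{ revert Bh; unfold ball; simpl; unfold AbsRing_ball, abs, minus, plus, opp.
  simpl; now replace (h + - 0) with h by (simpl; lra). }
apply H; intros m n Hm Hn u.
pose proof (Rmin_l 1 (d / (M + 1))); pose proof (Rmin_r 1 (d / (M + 1))).
eapply Rle_trans; [apply (HM m n Hm Hn); [exact Hh|lra]|].
(* [M + 1] instead of [M], which may vanish, in the denominator. *)
apply Rle_trans with ((M + 1) * (d / (M + 1))); [|right; field; lra].
pose proof (Rabs_pos h); apply Rmult_le_compat; lra.
Qed.

(** * The metamorphism *)

(** The value at [vu] is arbitrary: Schwartz functions are formed by varying
    that coordinate. *)
Definition point (x y b : R) : var -> R :=
  fun i => match i with vx => x | vy => y | vb => b | vu => 0 end.

Lemma schwartz_kernel_gauss x y b :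
  schwartz_kernel hbar x y b r = schwartz_gauss (Cst 1) (point x y b).
Proof.
apply schwartz_eq; intros u; simpl; unfold kernel, gauss; simpl.
rewrite Cmult_1_l; unfold upd, point; f_equal.
apply injective_projections; simpl; ring.
Qed.

Lemma tempered_gauss_is_CDerive (f : tempered) p e i t : i <> vu ->
  is_CDerive (fun s => f (schwartz_gauss p (upd e i s))) t
    (f (schwartz_gauss (twist i p) (upd e i t))).
Proof.
intros Hi.
apply (tempered_is_derive f (fun s => schwartz_gauss p (upd e i s))).
now apply gauss_schwartz_is_derive.
Qed.

(** The polynomial identity behind the theorem: after division by the common
    exponential factor both sides are polynomials in [x, y, b, u]. *)
Lemma gauss_intertwining x y b u :
  let e := upd (point x y b) vu u in
  let w := (b + Ci * r ^ 2)%C in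
  gauss (twist vu (twist vu (Cst 1))) e =
  (2 * PI * Ci * hbar *
    (w * x * gauss (twist vx (Cst 1)) e
     + x * gauss (twist vy (Cst 1)) e
     + 2 * w ^ 2 * gauss (twist vb (Cst 1)) e
     + w * gauss (Cst 1) e))%C.
Proof.
intros e w; unfold gauss.
set (K := Cexp _).
transitivity (eval (twist vu (twist vu (Cst 1))) e * K)%C; [reflexivity|].
assert (E : eval (twist vu (twist vu (Cst 1))) e =
  (2 * PI * Ci * hbar *
    (w * x * eval (twist vx (Cst 1)) e
     + x * eval (twist vy (Cst 1)) e
     + 2 * w ^ 2 * eval (twist vb (Cst 1)) e
     + w))%C).
{ unfold w, e, upd, point; simpl.
  replace (RtoC 2) with (1 + 1)%C by (rewrite <- RtoC_plus; f_equal; lra).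
  assert (I2 : (Ci * Ci = - (1))%C)
    by (apply injective_projections; simpl; ring).
  ring [I2]. }
rewrite E; simpl; ring.
Qed.

Lemma metamorphism_gauss (f : tempered) x y b :
  metamorphism hbar f x y b r =
  (sqrt (hbar * r) * f (schwartz_gauss (Cst 1) (point x y b)))%C.
Proof. unfold metamorphism; now rewrite schwartz_kernel_gauss. Qed.

Lemma metamorphism_is_CDerive (f : tempered) x y b :
  is_CDerive (fun t => metamorphism hbar f t y b r) x
    (sqrt (hbar * r) * f (schwartz_gauss (twist vx (Cst 1)) (point x y b))) /\
  is_CDerive (fun t => metamorphism hbar f x t b r) y
    (sqrt (hbar * r) * f (schwartz_gauss (twist vy (Cst 1)) (point x y b))) /\
  is_CDerive (fun t => metamorphism hbar f x y t r) b
    (sqrt (hbar * r) * f (schwartz_gauss (twist vb (Cst 1)) (point x y b))).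
Proof.
set (e := point x y b).
assert (D : forall i (F : R -> C), i <> vu ->
  (forall t, F t = sqrt (hbar * r) * f (schwartz_gauss (Cst 1) (upd e i t)))%C ->
  is_CDerive F (e i) (sqrt (hbar * r) * f (schwartz_gauss (twist i (Cst 1)) e))).
{ intros i F Hi HF.
  pose proof (tempered_gauss_is_CDerive f (Cst 1) e i (e i) Hi) as H.
  rewrite upd_id in H.
  eapply is_CDerive_ext; [|apply is_CDerive_scal, H].
  intros t; now rewrite HF. }
split; [|split].
1: apply (D vx); [discriminate|].
2: apply (D vy); [discriminate|].
3: apply (D vb); [discriminate|].
all: intros t; rewrite metamorphism_gauss; do 3 f_equal.
all: apply functional_extensionality; now intros [].
Qed.

End Gauss.

Theorem lemma4 (hbar : posreal) (f : tempered) (x y b : R) (r : posreal) :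
  ex_D0 (metamorphism hbar f) x y b r /\
  metamorphism hbar (tempered_deriv (tempered_deriv f)) x y b r
  = D0 hbar (metamorphism hbar f) x y b r.
Proof.
destruct (metamorphism_is_CDerive hbar r f x y b) as (Hx & Hy & Hb).
split.
{ split; [|split]; eapply is_CDerive_ex; eassumption. }
unfold D0, partial_x, partial_y, partial_b.
rewrite (is_CDerive_unique _ _ _ Hx), (is_CDerive_unique _ _ _ Hy),
  (is_CDerive_unique _ _ _ Hb), !metamorphism_gauss.
cbn [pairing tempered_deriv]; rewrite !schwartz_deriv_gauss.
set (w := (b + Ci * r ^ 2)%C).
set (e := point x y b).
set (G := fun p => schwartz_gauss hbar r p e).
set (k := (2 * PI * Ci * hbar)%C).
assert (E : G (twist hbar r vu (twist hbar r vu (Cst 1))) =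
  schwartz_scal k
    (schwartz_plus
      (schwartz_plus
        (schwartz_plus (schwartz_scal (w * x)%C (G (twist hbar r vx (Cst 1))))
                       (schwartz_scal x (G (twist hbar r vy (Cst 1)))))
        (schwartz_scal (2 * w ^ 2)%C (G (twist hbar r vb (Cst 1)))))
      (schwartz_scal w (G (Cst 1))))).
{ apply schwartz_eq; intros u; unfold G.
  cbn [schwartz_fun schwartz_plus schwartz_scal schwartz_gauss].
  exact (gauss_intertwining hbar r x y b u). }
fold (G (twist hbar r vu (twist hbar r vu (Cst 1)))); rewrite E.
destruct (tempered_prop f) as [Hp Hs _].
rewrite !Hs, !Hp, !Hs; unfold G; ring.
Qed.
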